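(* Let $K$ be an infinite field and $R=K[x_1,\ldots,x_n]$ the standard graded polynomial ring. Every componentwise linear ideal of $R$ is a completely $\mathfrak m$-full ideal.
   Context: All ideals are homogeneous. A statement holds for a general linear form $x$ if it holds for all $x$ in some nonempty Zariski open subset of the $K$-vector space $R_1$ of linear forms. Completely $\mathfrak m$-full ideals are homogeneous ideals of polynomial rings $R=K[x_1,\ldots,x_n]$ with homogeneous maximal ideal $\mathfrak m=(x_1,\ldots,x_n)$, defined recursively: (1) if $n=0$ (i.e. if $R$ is a field), the zero ideal is completely $\mathfrak m$-full; (2) if $n>0$, $I$ is completely $\mathfrak m$-full if $\mathfrak m I:x=I$ and $(I+xR)/xR$ is completely $\mathfrak m$-full as an ideal of $R/xR$ (a polynomial ring in $n-1$ variables), where $x$ is a general linear form. A homogeneous ideal $I$ is componentwise linear if for every $d$ the ideal $I_{\langle d\rangle}$ generated by all homogeneous polynomials of degree $d$ belonging to $I$ has a linear resolution, i.e. $\mathrm{Tor}^R_i(I_{\langle d\rangle},K)_{i+j}=0$ for all $i$ and all $j\ne d$ (the zero ideal is regarded as having a linear resolution).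
   Formalization: The ideal is assumed proper: the unit ideal R is componentwise linear (its components are the powers of the maximal ideal) but is not completely m-full, since over a field only the zero ideal is. *)

(* Defs.v *)
From HB Require Import structures.
From mathcomp Require Import all_boot all_order all_algebra.
From mathcomp.multinomials Require Export mpoly.

Set Implicit Arguments.
Unset Strict Implicit.
Unset Printing Implicit Defensive.

Import GRing.Theory.
Local Open Scope ring_scope.

Definition infinite_type (T : eqType) : Prop :=
  forall s : seq T, exists x, x \notin s.

Section Ideals.
Variables (K : fieldType) (n : nat).
Local Notation R := {mpoly K[n]}.
Implicit Types (I J S : R -> Prop) (f g x : R).

Record is_ideal I : Prop := IsIdeal {
  ideal0 : I 0;
  idealD : forall f g, I f -> I g -> I (f + g);
  idealM : forall f g, I g -> I (f * g)
}.

Definition ideal_gen S : R -> Prop := fun f =>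
  exists2 s : seq (R * R), (forall c, c \in s -> S c.2)
                         & f = \sum_(c <- s) c.1 * c.2.

Definition homogeneous_ideal I : Prop :=
  is_ideal I /\ forall f d, I f -> I (pihomog mdeg d f).

Definition ideal_add I J : R -> Prop := fun f =>
  exists g h, [/\ I g, J h & f = g + h].

Definition ideal_mul I J : R -> Prop :=
  ideal_gen (fun f => exists g h, [/\ I g, J h & f = g * h]).

Definition ideal_colon I x : R -> Prop := fun f => I (f * x).

Definition principal x : R -> Prop := ideal_gen (fun f => f = x).

Definition maximal_ideal : R -> Prop := ideal_gen (fun f => exists i, f = 'X_i).

Definition degree_part I (d : nat) : R -> Prop :=
  ideal_gen (fun f => I f /\ f \is d.-homog).

Definition linear_form (a : 'I_n -> K) : R := \sum_(i < n) a i *: 'X_i.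

Definition zariski_open (U : ('I_n -> K) -> Prop) : Prop :=
  exists S : R -> Prop, forall a, U a <-> exists2 f, S f & f.@[a] != 0.

(* The K-space of linear forms is identified with K^n by [linear_form]. *)
Definition for_general_linear_form (P : R -> Prop) : Prop :=
  exists U : ('I_n -> K) -> Prop,
    [/\ zariski_open U, exists a, U a & forall a, U a -> P (linear_form a)].

End Ideals.

(* [coords] are the images of the variables under a surjective homomorphism of *)
(* graded K-algebras K[x_1,..,x_n] -> K[y_1,..,y_k] with kernel (x), that is,  *)
(* under an identification of R/xR with a polynomial ring in k variables.      *)
Record quotient_coords (K : fieldType) (n k : nat) (x : {mpoly K[n]})
    (coords : n.-tuple {mpoly K[k]}) : Prop := QuotientCoords {
  coords_linear : forall i, tnth coords i \is 1.-homog;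
  coords_surj : forall q, exists p, p \mPo coords = q;
  coords_ker : forall p, p \mPo coords = 0 <-> principal x p
}.

Definition image_ideal (K : fieldType) (n k : nat)
    (coords : n.-tuple {mpoly K[k]}) (I : {mpoly K[n]} -> Prop) :
    {mpoly K[k]} -> Prop :=
  fun q => exists2 p, I p & q = p \mPo coords.

Fixpoint completely_mfull (K : fieldType) (n : nat) :
    ({mpoly K[n]} -> Prop) -> Prop :=
  match n with
  | 0 => fun I => forall f, I f <-> f = 0
  | k.+1 => fun I => for_general_linear_form (fun x =>
      (forall f, ideal_colon (ideal_mul (@maximal_ideal K k.+1) I) x f <-> I f)
      /\ exists coords : k.+1.-tuple {mpoly K[k]},
           quotient_coords x coords /\
           completely_mfull (image_ideal coords (ideal_add I (principal x))))
  end.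

(* A graded free resolution                                                    *)
(*   ... -> F_2 -> F_1 -> F_0 -> I -> 0                                        *)
(* with F_i = \bigoplus_a R(- gdeg i a), a < rk i. Elements of F_i are row     *)
(* vectors, and maps act by multiplication on the right. Finite ranks suffice, *)
(* as R is Noetherian.                                                         *)
Record graded_free_resolution (K : fieldType) (n : nat)
    (I : {mpoly K[n]} -> Prop) : Type := GradedFreeResolution {
  rk : nat -> nat;
  gdeg : forall i, 'I_(rk i) -> int;
  diff : forall i, 'M[{mpoly K[n]}]_(rk i.+1, rk i);
  aug : 'cV[{mpoly K[n]}]_(rk 0);
  diff_graded : forall i a b m,
    m \in msupp (diff i a b) -> gdeg a = gdeg b + (mdeg m)%:Z;
  aug_graded : forall a m, m \in msupp (aug a ord0) -> gdeg a = (mdeg m)%:Z;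
  aug_image : forall f, I f <-> exists v : 'rV_(rk 0), (v *m aug) ord0 ord0 = f;
  exact0 : forall v : 'rV_(rk 0),
    v *m aug = 0 <-> exists w : 'rV_(rk 1), v = w *m diff 0;
  exactS : forall i (v : 'rV_(rk i.+1)),
    v *m diff i = 0 <-> exists w : 'rV_(rk i.+2), v = w *m diff i.+1
}.

Section Tor.
Variables (K : fieldType) (n : nat) (I : {mpoly K[n]} -> Prop).
Variable F : graded_free_resolution I.

(* The complex F (x)_R K, where K = R/m: reducing the entries modulo m amounts *)
(* to taking their constant coefficients.                                      *)
Definition diffK i : 'M[K]_(rk F i.+1, rk F i) :=
  map_mx (fun p : {mpoly K[n]} => p@_0%MM) (diff F i).

Definition in_degree i (v : 'rV[K]_(rk F i)) (k : int) : Prop :=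
  forall a, v ord0 a != 0 -> gdeg a = k.

Definition cycleK i : 'rV[K]_(rk F i) -> Prop :=
  match i with
  | 0 => fun=> True
  | j.+1 => fun v => v *m diffK j = 0
  end.

(* H_i(F (x)_R K)_k = 0, i.e. Tor^R_i(I, K)_k = 0 computed from F. *)
Definition Tor_vanishes (i : nat) (k : int) : Prop :=
  forall v, in_degree v k -> cycleK v ->
    exists2 w : 'rV[K]_(rk F i.+1), in_degree w k & v = w *m diffK i.

End Tor.

(* Tor does not depend on the resolution used to compute it. *)
Definition has_linear_resolution (K : fieldType) (n : nat)
    (I : {mpoly K[n]} -> Prop) (d : nat) : Prop :=
  exists F : graded_free_resolution I,
    forall (i : nat) (j : int), j != d%:Z -> Tor_vanishes F i (i%:Z + j).

Definition componentwise_linear (K : fieldType) (n : nat)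
    (I : {mpoly K[n]} -> Prop) : Prop :=
  forall d : nat, has_linear_resolution (degree_part I d) d.

(* Main.v *)
(** Read degree by degree, the condition [m I : x = I] says that
    [(I_<d> : x)_d = I_d] for all [d]. The invariant kept along the recursion is
    that every [I_<d>] is [d]-regular, in the following weak form: [R/I_<d>] is
    the zeroth homology of a complex [G] of graded free modules such that
    [H_i(G)_k] and [H_i(G (x) K)_k] vanish for all [i >= 1] and [k >= d + i].
    A linear resolution provides such a [G].

    Cutting such complexes by one variable after the other shows that
    [R/I_<d>] has no socle in degrees [>= d]. A general linear form [x] acts on
    [R/I_<d>] with a kernel of [m]-power torsion, hence injectively in degrees
    [>= d]; one [x] serves all [d], as [I] is generated in bounded degree. This
    gives [m I : x = I], and it also shows that [G/xG] only acquires homology in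
    low degrees, so that the image of [I] in [R/xR] inherits the invariant. *)

Require Import Defs.
From HB Require Import structures.
From mathcomp Require Import all_boot all_order all_algebra.
From mathcomp Require Import zify.
From Stdlib Require Import Classical ClassicalEpsilon.

Set Implicit Arguments.
Unset Strict Implicit.
Unset Printing Implicit Defensive.

Import Order.TTheory GRing.Theory.
Local Open Scope ring_scope.

(** * Graded pieces and substitutions *)

Section GradedPieces.
Variables (K : fieldType) (n : nat).
Implicit Types (f g : {mpoly K[n]}).

(** Degrees are integers because the entries of a vector of degree [k] have degrees [k - gd a],
    which may be negative. *)
Definition hcomp (k : int) f : {mpoly K[n]} :=
  if k is Posz d then pihomog mdeg d f else 0.

Lemma hcomp_is_linear k : linear (hcomp k).
Proof. by case: k => d c f g /=; rewrite ?linearP // scaler0 addr0. Qed.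
HB.instance Definition _ k :=
  GRing.isLinear.Build K {mpoly K[n]} {mpoly K[n]} _ (hcomp k)
    (hcomp_is_linear k).

Lemma hcomp_homog k e f : f \is e.-homog ->
  hcomp k f = if k == e%:Z then f else 0.
Proof.
case: k => d hf /=; last by [].
rewrite eqz_nat; have [->|nde] := eqVneq d e; first by rewrite pihomog_dE.
by rewrite (pihomog_ne0 _ hf) // eq_sym.
Qed.

Lemma hcomp_id k f : hcomp k (hcomp k f) = hcomp k f.
Proof. by case: k => d //=; rewrite pihomog_id. Qed.

Lemma hcompM k e f g : g \is e.-homog ->
  hcomp (k + e%:Z) (f * g) = hcomp k f * g.
Proof.
move=> hg; elim/mpolyind: f => [|c m p _ _ IH].
  by rewrite mul0r !linear0 mul0r.
rewrite mulrDl !linearD /= IH mulrDl -scalerAl !linearZ /= -scalerAl.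
congr (_ *: _ + _).
have hm : ('X_[m] : {mpoly K[n]}) \is (mdeg m).-homog by rewrite dhomogX.
rewrite (hcomp_homog _ (dhomogM hm hg)) (hcomp_homog _ hm).
rewrite PoszD (inj_eq (addIr _)).
by case: eqP => // _; rewrite mul0r.
Qed.

End GradedPieces.

Section GradedVectors.
Variables (K : fieldType) (n : nat).
Local Notation R := {mpoly K[n]}.

Definition vproj r (gd : 'I_r -> int) (k : int) (v : 'rV[R]_r) : 'rV[R]_r :=
  \row_a hcomp (k - gd a) (v ord0 a).


Variables (r s : nat) (gr : 'I_r -> int) (gs : 'I_s -> int).

Lemma vprojB k (u v : 'rV_r) : vproj gr k (u - v) = vproj gr k u - vproj gr k v.
Proof. by apply/rowP => a; rewrite !mxE linearB. Qed.

Lemma vproj_id k (u : 'rV_r) : vproj gr k (vproj gr k u) = vproj gr k u.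
Proof. by apply/rowP => a; rewrite !mxE hcomp_id. Qed.

Lemma vproj_scale k e (l : R) (u : 'rV_r) : l \is e.-homog ->
  vproj gr (k + e%:Z) (l *: u) = l *: vproj gr k u.
Proof.
move=> hl; apply/rowP => a; rewrite !mxE mulrC addrAC hcompM //.
by rewrite mulrC.
Qed.

Lemma vproj_mulmx k (D : 'M[R]_(r, s)) (v : 'rV_r) :
  (forall a b m, m \in msupp (D a b) -> gr a = gs b + (mdeg m)%:Z) ->
  vproj gs k (v *m D) = vproj gr k v *m D.
Proof.
move=> hD; apply/rowP => b; rewrite !mxE linear_sum; apply: eq_bigr => a _.
rewrite !mxE; have [->|nz] := eqVneq (D a b) 0.
  by rewrite !mulr0 linear0.
have hg := hD a b _ (mlead_supp nz).
have hom : D a b \is (mdeg (mlead (D a b))).-homog.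
  by apply/dhomogP => m /hD; rewrite hg => /addrI [].
by rewrite -(hcompM _ _ hom) hg opprD addrA subrK.
Qed.

End GradedVectors.

Section Substitution.
Variables (K : fieldType) (n k : nat) (c : n.-tuple {mpoly K[k]}).
Hypothesis c_linear : forall i, tnth c i \is 1.-homog.

Lemma comp_mpoly_homogX m : 'X_[m] \mPo c \is (mdeg m).-homog.
Proof.
rewrite comp_mpolyX mdegE.
elim/big_rec2: _ => [|i d p _ hp]; first exact: dhomog1.
by apply: dhomogM => //; have := dhomogMn (m i) (c_linear i); rewrite mul1n.
Qed.

Lemma hcomp_comp_mpoly d p : hcomp d (p \mPo c) = hcomp d p \mPo c.
Proof.
elim/mpolyind: p => [|a m p _ _ IH]; first by rewrite !linear0.
rewrite !linearD /= IH !linearZ /=; congr (_ *: _ + _).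
have hm : ('X_[m] : {mpoly K[n]}) \is (mdeg m).-homog by rewrite dhomogX.
rewrite (hcomp_homog _ (comp_mpoly_homogX m)) (hcomp_homog _ hm).
by case: eqP => // _; rewrite linear0.
Qed.

(** Substituting linear forms keeps degrees, so only the monomial 1 contributes to the constant
    term. Hence a cut leaves the matrices [fc_dK] unchanged. *)
Lemma mcoeff0_comp_mpoly p : (p \mPo c)@_0%MM = p@_0%MM.
Proof.
elim/mpolyind: p => [|a m p _ _ IH]; first by rewrite linear0 !mcoeff0.
rewrite linearD linearZ /= !mcoeffD !mcoeffZ IH; congr (_ * _ + _).
have [->|nm0] := eqVneq m 0%MM.
  by rewrite mpolyX0 comp_mpoly1 !mcoeff1 !eqxx.
have ne : mdeg (0%MM : 'X_{1..k}) != mdeg m by rewrite mdeg0 eq_sym mdeg_eq0.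
by rewrite mcoeffX (negbTE nm0) (dhomog_nemf_coeff (comp_mpoly_homogX m) ne).
Qed.

Lemma vproj_map_comp r (gd : 'I_r -> int) d v :
  vproj gd d (map_mx (comp_mpoly c) v) = map_mx (comp_mpoly c) (vproj gd d v).
Proof. by apply/rowP => a; rewrite !mxE hcomp_comp_mpoly. Qed.

End Substitution.

Lemma principalP (K : fieldType) n (x p : {mpoly K[n]}) :
  principal x p <-> exists q, p = q * x.
Proof.
split=> [[s hs ->]|[q ->]].
  exists (\sum_(c <- s) c.1); rewrite mulr_suml big_seq [RHS]big_seq.
  by apply: eq_bigr => i /hs ->.
by exists [:: (q, x)]; rewrite ?big_seq1 // => c; rewrite inE => /eqP ->.
Qed.

Section Quotient.
Variables (K : fieldType) (n k : nat) (x : {mpoly K[n]}).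
Variable c : n.-tuple {mpoly K[k]}.
Hypothesis qc : quotient_coords x c.

Lemma quotient_coords_x : x \mPo c = 0.
Proof. by apply/(coords_ker qc)/principalP; exists 1; rewrite mul1r. Qed.

Lemma map_comp_eq0 r (v : 'rV_r) : map_mx (comp_mpoly c) v = 0 ->
  exists t, v = x *: t.
Proof.
move=> hv; have /fin_all_exists[t ht] a : exists q, v ord0 a = q * x.
  apply/principalP/(coords_ker qc).
  by have /rowP/(_ a) := hv; rewrite !mxE.
by exists (\row_a t a); apply/rowP => a; rewrite !mxE ht mulrC.
Qed.

Lemma map_comp_surj r (w : 'rV_r) : exists v, map_mx (comp_mpoly c) v = w.
Proof.
have /fin_all_exists[t ht] a : exists p, p \mPo c = w ord0 a.
  exact: (coords_surj qc).
by exists (\row_a t a); apply/rowP => a; rewrite !mxE.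
Qed.

Lemma map_comp_scale r (f : {mpoly K[n]}) (v : 'rV_r) :
  map_mx (comp_mpoly c) (f *: v) = (f \mPo c) *: map_mx (comp_mpoly c) v.
Proof. exact: map_mxZ. Qed.

End Quotient.

(** * Complexes of graded free modules *)

(** Exactness is left out of the structure: a cut may create homology, and only its vanishing in
    certain degrees is tracked. *)
Record free_complex (K : fieldType) (n : nat) : Type := FreeComplex {
  fc_rk : nat -> nat;
  fc_deg : forall i, 'I_(fc_rk i) -> int;
  fc_d : forall i, 'M[{mpoly K[n]}]_(fc_rk i.+1, fc_rk i);
  fc_graded : forall i a b m,
    m \in msupp (fc_d i a b) -> fc_deg a = fc_deg b + (mdeg m)%:Z;
  fc_dd : forall i, fc_d i.+1 *m fc_d i = 0
}.

Section Homology.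
Variables (K : fieldType) (n : nat) (G : free_complex K n).

Definition homog_vec i (k : int) (v : 'rV[{mpoly K[n]}]_(fc_rk G i)) : Prop :=
  vproj (@fc_deg _ _ G i) k v = v.

Definition fc_im i (v : 'rV[{mpoly K[n]}]_(fc_rk G i)) : Prop :=
  exists w, v = w *m fc_d G i.

(* [exact_at i k] is the vanishing of H_{i+1}(G)_k, and [torK_at i k] that of *)
(* H_{i+1}(G (x) K)_k.                                                        *)
Definition exact_at i (k : int) : Prop :=
  forall v : 'rV[{mpoly K[n]}]_(fc_rk G i.+1),
    homog_vec k v -> v *m fc_d G i = 0 -> fc_im v.

Definition fc_dK i : 'M[K]_(fc_rk G i.+1, fc_rk G i) :=
  map_mx (fun p : {mpoly K[n]} => p@_0%MM) (fc_d G i).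

Definition torK_at i (k : int) : Prop :=
  forall v : 'rV[K]_(fc_rk G i.+1),
    (forall a, v ord0 a != 0 -> fc_deg a = k) -> v *m fc_dK i = 0 ->
    exists w, v = w *m fc_dK i.+1.

Lemma fc_im_homog i k (v : 'rV[{mpoly K[n]}]_(fc_rk G i)) :
  homog_vec k v -> fc_im v ->
  exists2 w, homog_vec k w & v = w *m fc_d G i.
Proof.
move=> hv [w hw]; exists (vproj (@fc_deg _ _ G i.+1) k w).
  exact: vproj_id.
by rewrite -(vproj_mulmx _ _ (@fc_graded _ _ G i)) -hw.
Qed.

Lemma homog_vecB i k (u v : 'rV[{mpoly K[n]}]_(fc_rk G i)) :
  homog_vec k u -> homog_vec k v -> homog_vec k (u - v).
Proof. by rewrite /homog_vec vprojB => -> ->. Qed.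

Lemma homog_vecZ i k (l : {mpoly K[n]}) (v : 'rV[{mpoly K[n]}]_(fc_rk G i)) :
  l \is 1.-homog -> homog_vec (k - 1) v -> homog_vec k (l *: v).
Proof.
move=> hl hv; rewrite /homog_vec -[k](subrK 1).
by rewrite (vproj_scale _ _ _ hl) hv.
Qed.

Lemma homog_vecZ_inv i k (l : {mpoly K[n]}) (v : 'rV[{mpoly K[n]}]_(fc_rk G i)) :
  l \is 1.-homog -> l != 0 -> homog_vec k (l *: v) -> homog_vec (k - 1) v.
Proof.
move=> hl nzl; rewrite /homog_vec -[k](subrK 1).
rewrite (vproj_scale _ _ _ hl) addrK => /rowP h; apply/rowP => a.
by have := h a; rewrite !mxE => /(mulfI nzl).
Qed.

Lemma homog_vecM i k (v : 'rV[{mpoly K[n]}]_(fc_rk G i.+1)) :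
  homog_vec k v -> homog_vec k (v *m fc_d G i).
Proof.
by move=> hv; rewrite /homog_vec (vproj_mulmx _ _ (@fc_graded _ _ G i)) hv.
Qed.

End Homology.

Lemma scale_row_inj (K : fieldType) n r (x : {mpoly K[n]})
    (u v : 'rV[{mpoly K[n]}]_r) :
  x != 0 -> x *: u = x *: v -> u = v.
Proof.
move=> nzx /rowP h; apply/rowP => a; have := h a; rewrite !mxE.
exact: mulfI.
Qed.

Section Cut.
Variables (K : fieldType) (n m : nat) (c : n.-tuple {mpoly K[m]}).
Hypothesis c_linear : forall i, tnth c i \is 1.-homog.
Variable G : free_complex K n.

Lemma cut_graded i a b mm :
  mm \in msupp (map_mx (comp_mpoly c) (fc_d G i) a b) ->
  fc_deg a = fc_deg b + (mdeg mm)%:Z.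
Proof.
rewrite mxE; have [->|nz] := eqVneq (fc_d G i a b) 0.
  by rewrite linear0 msupp0.
have hg := fc_graded (mlead_supp nz).
have hom : fc_d G i a b \is (mdeg (mlead (fc_d G i a b))).-homog.
  by apply/dhomogP => m' /fc_graded; rewrite hg => /addrI [].
have := hcomp_comp_mpoly c_linear (mdeg (mlead (fc_d G i a b)))%:Z
  (fc_d G i a b).
rewrite (hcomp_homog _ hom) eqxx /= => /eqP.
by rewrite -homog_piE hg => /dhomogP h /h <-.
Qed.

Lemma cut_dd i : map_mx (comp_mpoly c) (fc_d G i.+1)
  *m map_mx (comp_mpoly c) (fc_d G i) = 0.
Proof. by rewrite -map_mxM fc_dd map_mx0. Qed.

Definition cut : free_complex K m := FreeComplex cut_graded cut_dd.

Lemma cut_torK i k : torK_at G i k -> torK_at cut i k.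
Proof.
have e j : fc_dK cut j = fc_dK G j.
  by apply/matrixP => a b; rewrite !mxE mcoeff0_comp_mpoly.
by move=> h; rewrite /torK_at !e.
Qed.

Variable x : {mpoly K[n]}.
Hypotheses (qc : quotient_coords x c) (nzx : x != 0) (hx : x \is 1.-homog).
Local Notation phi := (map_mx (comp_mpoly c)).

Lemma cut_lift i k (w : 'rV[{mpoly K[m]}]_(fc_rk cut i)) : homog_vec k w ->
  exists2 v : 'rV[{mpoly K[n]}]_(fc_rk G i), homog_vec k v & phi v = w.
Proof.
move=> hw; have [v hv] := map_comp_surj qc w.
exists (vproj (@fc_deg _ _ G i) k v); first exact: vproj_id.
by rewrite -vproj_map_comp // hv.
Qed.

(* The connecting map H_{i+1}(G/xG)_k -> H_i(G)_{k-1} lands in the kernel of  *)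
(* multiplication by x, so injectivity of x on coker d_i kills it.            *)
Lemma cut_exact i k :
  (forall t : 'rV[{mpoly K[n]}]_(fc_rk G i),
    homog_vec (k - 1) t -> fc_im (x *: t) -> fc_im t) ->
  exact_at G i k -> exact_at cut i k.
Proof.
move=> inj ex w hw dw; have [v hv vw] := cut_lift hw.
have [|t ht] := map_comp_eq0 qc (v := v *m fc_d G i).
  by rewrite map_mxM vw.
have homt : homog_vec (k - 1) t.
  by apply: (homog_vecZ_inv hx nzx); rewrite -ht; apply: homog_vecM.
have [|s homs ds] := fc_im_homog homt.
  by apply: inj => //; exists v.
have [||z hz] := ex (v - x *: s).
- by apply: homog_vecB => //; apply: homog_vecZ.
- by rewrite mulmxBl -scalemxAl -ds ht subrr.
exists (phi z); rewrite -map_mxM -hz map_mxB map_comp_scale.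
rewrite (quotient_coords_x qc) //.
by rewrite scale0r subr0 vw.
Qed.

(** The injectivity that [cut_exact] asks for is automatic here: if [x t] is a boundary, then
    [x d t = 0], so [t] is a cycle of degree [k - 1], and exactness makes it a boundary. *)
Lemma cut_exactS i k :
  exact_at G i (k - 1) -> exact_at G i.+1 k -> exact_at cut i.+1 k.
Proof.
move=> ex; apply: cut_exact => t homt [w hw]; apply: ex => //.
apply: (scale_row_inj nzx); rewrite scalemxAl hw -mulmxA fc_dd.
by rewrite mulmx0 scaler0.
Qed.

End Cut.

(** * Vanishing of the socle *)

Lemma mpoly0_const (K : fieldType) (f : {mpoly K[0]}) : f = (f@_0%MM)%:MP.
Proof.
apply/mpolyP => m; rewrite mcoeffC.
have -> : m = 0%MM by apply/mnmP; case.
by rewrite eqxx mulr1.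
Qed.

Lemma mpolyX1_homog (K : fieldType) n (i : 'I_n) :
  ('X_i : {mpoly K[n]}) \is 1.-homog.
Proof. by rewrite dhomogX; apply/eqP/mdeg1. Qed.

Lemma linear_form_homog (K : fieldType) n (a : 'I_n -> K) :
  linear_form a \is 1.-homog.
Proof. by apply: rpred_sum => i _; apply/rpredZ; exact: mpolyX1_homog. Qed.

Lemma mcoeff_linear_form (K : fieldType) n (a : 'I_n -> K) i :
  (linear_form a)@_U_(i)%MM = a i.
Proof.
rewrite /linear_form linear_sum (bigD1 i) //= mcoeffZ mcoeffX eqxx mulr1.
rewrite big1 ?addr0 // => j nji; rewrite mcoeffZ mcoeffX.
by rewrite eq_mnm1 (negbTE nji) mulr0.
Qed.

Lemma comp_mpoly_comp (K : fieldType) n k l (u : n.-tuple {mpoly K[k]})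
    (v : k.-tuple {mpoly K[l]}) p :
  (p \mPo u) \mPo v = p \mPo [tuple tnth u i \mPo v | i < n].
Proof.
rewrite (comp_mpolyEX p u) [RHS]comp_mpolyEX linear_sum; apply: eq_bigr => m _.
rewrite linearZ /= !comp_mpolyX; congr (_ *: _).
rewrite rmorph_prod; apply: eq_bigr => i _.
by rewrite rmorphXn tnth_mktuple.
Qed.

Section ModX.
Variables (K : fieldType) (n : nat) (x : {mpoly K[n]}).
Implicit Types p q : {mpoly K[n]}.
Let cong p q := exists r, p - q = r * x.

Let congM p q p' q' : cong p q -> cong p' q' -> cong (p * p') (q * q').
Proof.
move=> [r hr] [r' hr']; exists (r * p' + q * r').
by rewrite mulrDl mulrAC -hr -mulrA -hr' mulrBl mulrBr addrA subrK.
Qed.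

Lemma comp_mpoly_mod (t : n.-tuple {mpoly K[n]}) p :
  (forall i, exists r, 'X_i - tnth t i = r * x) ->
  exists r, p - (p \mPo t) = r * x.
Proof.
move=> ht; elim/mpolyind: p => [|c m p _ _ [r IH]].
  by exists 0; rewrite comp_mpoly0 mul0r subrr.
have [s hs] : cong 'X_[m] ('X_[m] \mPo t).
  rewrite comp_mpolyX mpolyXE_id; elim/big_rec2: _ => [|i p1 p2 _ h].
    by exists 0; rewrite mul0r subrr.
  apply: congM => //; elim: (m i) => [|j IHj].
    by exists 0; rewrite mul0r subrr.
  by rewrite !exprS; apply: congM.
exists (c *: s + r); rewrite linearD linearZ /= mulrDl -scalerAl -IH -hs.
by rewrite scalerBr opprD addrACA.
Qed.

End ModX.

(** The equation [linear_form a = 0] is solved for the first variable: [y] is the solution, and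
    [psi] embeds the other variables back. *)
Lemma quotient_coords_linear_form (K : fieldType) n (a : 'I_n.+1 -> K) :
  a ord0 != 0 ->
  exists c : n.+1.-tuple {mpoly K[n]}, quotient_coords (linear_form a) c.
Proof.
move=> nz.
pose y := - \sum_j (a (lift ord0 j) / a ord0) *: ('X_j : {mpoly K[n]}).
pose c := [tuple if unlift ord0 i is Some j then 'X_j else y | i < n.+1].
pose psi := [tuple ('X_(lift ord0 j) : {mpoly K[n.+1]}) | j < n].
have c0 : tnth c ord0 = y by rewrite tnth_mktuple unlift_none.
have cS j : tnth c (lift ord0 j) = 'X_j by rewrite tnth_mktuple liftK.
have XU k l (t : k.-tuple {mpoly K[l]}) i : 'X_i \mPo t = tnth t i.
  by rewrite comp_mpolyXU -tnth_nth.
have phix : linear_form a \mPo c = 0.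
  rewrite linear_sum big_ord_recl linearZ /= XU c0 scalerN scaler_sumr.
  apply/eqP; rewrite addrC subr_eq0; apply/eqP; apply: eq_bigr => j _.
  by rewrite linearZ /= XU cS scalerA mulrCA divff ?mulr1.
exists c; split.
- move=> i; rewrite tnth_mktuple; case: unliftP => [j _|_].
    by exact: mpolyX1_homog.
  by rewrite rpredN; apply: rpred_sum => j _; apply/rpredZ; exact: mpolyX1_homog.
- move=> q; exists (q \mPo psi); rewrite comp_mpoly_comp -[RHS]comp_mpoly_id.
  by congr comp_mpoly; apply: eq_from_tnth => j; rewrite !tnth_mktuple XU cS.
move=> p; split=> [hp|/principalP[q ->]]; last by rewrite rmorphM /= phix mulr0.
apply/principalP.
(* Applying [c] and then [psi] is the identity modulo the linear form, so a [p] killed by [c] is a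
   multiple of it. *)
have [|r] := @comp_mpoly_mod _ _ (linear_form a)
    [tuple tnth c i \mPo psi | i < n.+1] p; last first.
  by rewrite -comp_mpoly_comp hp linear0 subr0; exists r.
move=> i; rewrite tnth_mktuple; case: (unliftP ord0 i) => [j ->|->].
  by exists 0; rewrite mul0r cS XU tnth_mktuple subrr.
exists ((a ord0)^-1)%:MP; rewrite c0 linearN opprK mul_mpolyC.
rewrite /linear_form big_ord_recl scalerDr scalerA mulVf // scale1r.
congr (_ + _); rewrite linear_sum scaler_sumr; apply: eq_bigr => j _.
by rewrite linearZ /= XU tnth_mktuple scalerA mulrC.
Qed.

Section Socle.
Variable K : fieldType.

(** As [exact_at G i] concerns H_{i+1}, the bound on [k] is [d] plus the homological degree. *)
Definition exact_from n (G : free_complex K n) (p : nat) (d : int) : Prop :=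
  forall i k, (p <= i)%N -> (d + i%:Z + 1 <= k)%R -> exact_at G i k.

Definition torK_from n (G : free_complex K n) (d : int) : Prop :=
  forall i k, (d + i%:Z + 1 <= k)%R -> torK_at G i k.

Definition fc_cycle n (G : free_complex K n) i :
    'rV[{mpoly K[n]}]_(fc_rk G i) -> Prop :=
  match i with
  | 0 => fun=> True
  | j.+1 => fun v => v *m fc_d G j = 0
  end.

(* If x u = d v, then v is a socle element of coker(G_{p+2} -> G_{p+1})/x, and *)
(* u is a boundary as soon as v is one modulo x. So each cut by a variable     *)
(* raises p by one, until no variable is left and G = G (x) K.                 *)
Lemma socle_vanishes n (G : free_complex K n) p (d e : int)
    (u : 'rV[{mpoly K[n]}]_(fc_rk G p)) :
  (0 < n + p)%N -> exact_from G p d -> torK_from G d ->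
  (d + p%:Z <= e)%R -> homog_vec e u ->
  fc_cycle u ->
  (forall l, l \is 1.-homog -> fc_im (l *: u)) -> fc_im u.
Proof.
elim: n G p e u => [|n IH] G p e u np ex tor dpe homu cyc soc.
  (* No variable is left, so [p] is positive and the entries of [u] are constants: [u] is its own
     reduction [u0], a cycle to which [tor] applies. *)
  case: p np u ex dpe homu cyc soc => // q _ u ex dpe homu cyc _.
  pose u0 := map_mx (fun f : {mpoly K[0]} => f@_0%MM) u.
  have [] := tor q e _ u0.
  - by move: dpe; rewrite intS; lia.
  - move=> a; rewrite mxE => nza.
    have := congr1 (fun w : 'rV__ => (w ord0 a)@_0%MM) homu; rewrite !mxE.
    rewrite (@hcomp_homog _ _ _ 0) ?nvar0_homog //.
    case: eqP => [h _|_ h]; last by rewrite -h mcoeff0 eqxx in nza.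
    by move/eqP: h; rewrite subr_eq0 => /eqP.
  - by rewrite -map_mxM cyc map_mx0.
  move=> w hw; exists (map_mx (@mpolyC 0 K) w).
  apply/rowP => a; have := congr1 (fun w : 'rV__ => w ord0 a) hw.
  rewrite !mxE => ea; rewrite [u ord0 a]mpoly0_const ea rmorph_sum.
  apply: eq_bigr => b _.
  by rewrite !mxE rmorphM /= -mpoly0_const.
pose a (i : 'I_n.+1) : K := (i == ord0)%:R.
have a0 : a ord0 != 0 by rewrite /a eqxx oner_eq0.
have [c qc] := quotient_coords_linear_form a0.
have hx := linear_form_homog a; set x := linear_form a in qc hx.
have nzx : x != 0.
  by apply: contraNneq a0 => x0; rewrite -mcoeff_linear_form -/x x0 mcoeff0.
have hxu : homog_vec (e + 1) (x *: u) by apply: homog_vecZ; rewrite ?addrK.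
have [v homv dv] := fc_im_homog hxu (soc x hx).
pose G' := cut (coords_linear qc) G.
have [] := IH G' p.+1 (e + 1) (map_mx (comp_mpoly c) v).
- by rewrite addnS.
- case=> // i k pi hk; apply: (cut_exactS qc nzx hx); apply: ex => //.
    by move: hk; rewrite intS; lia.
  exact: leqW.
- by move=> i k hk; apply: cut_torK; apply: tor.
- by move: dpe; rewrite intS; lia.
- by rewrite /homog_vec vproj_map_comp ?homv //; apply: coords_linear qc.
- rewrite /= -map_mxM -dv.
  by rewrite map_comp_scale (quotient_coords_x qc) scale0r.
(* The socle condition for [v] modulo [x]: if [l u = d w], then [l v - x w] is a cycle, hence a
   boundary, and it reduces to [l v]. *)
- move=> l' hl'; have [l0 hl0] := coords_surj qc l'.
  pose l := hcomp 1 l0.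
  have hl : l \is 1.-homog by apply: pihomogP.
  have phil : l \mPo c = l'.
    rewrite -hcomp_comp_mpoly ?hl0; last exact: coords_linear qc.
    by rewrite (hcomp_homog _ hl') eqxx.
  have hlu : homog_vec (e + 1) (l *: u) by apply: homog_vecZ; rewrite ?addrK.
  have [w homw dw] := fc_im_homog hlu (soc l hl).
  have [] := ex p (e + 2) _ _ (l *: v - x *: w).
  + by [].
  + by lia.
  + by apply: homog_vecB; apply: homog_vecZ; rewrite // -addrA.
  + by rewrite mulmxBl -!scalemxAl -dv -dw !scalerA mulrC subrr.
  move=> z hz; exists (map_mx (comp_mpoly c) z).
  rewrite -map_mxM -hz map_mxB !map_comp_scale phil (quotient_coords_x qc).
  by rewrite scale0r subr0.
(* Lifting back, [v = d z' + x t], so [x u = d v = x d t], and cancelling [x] gives [u = d t]. *)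
move=> z hz; have [z' hz'] := map_comp_surj qc z.
have [|t ht] := map_comp_eq0 qc (v := v - z' *m fc_d G p.+1).
  by rewrite map_mxB map_mxM hz' hz subrr.
exists t; apply: (scale_row_inj nzx); rewrite dv scalemxAl -ht.
by rewrite mulmxBl -mulmxA fc_dd mulmx0 subr0.
Qed.

End Socle.

(** * Noetherianity and general linear forms *)

Lemma strict_mono_leq (phi : nat -> nat) i j :
  (forall i, phi i < phi i.+1)%N -> (i <= j)%N -> (phi i <= phi j)%N.
Proof.
move=> mono /subnK <-; elim: (j - i)%N => // k IHk.
by apply: leq_trans IHk _; rewrite addSn ltnW.
Qed.

(** Each next index is one where [u] attains its minimum over the tail beyond the previous index. *)
Lemma nondecreasing_subsequence (u : nat -> nat) :
  exists2 phi : nat -> nat, (forall i, phi i < phi i.+1)%N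
    & forall i j, (i <= j)%N -> (u (phi i) <= u (phi j))%N.
Proof.
have min N : exists m, (N <= m)%N /\ forall k, (N <= k)%N -> (u m <= u k)%N.
  have [k leNk ek] : exists2 k, (N <= k)%N & u k = u N by exists N.
  move: k leNk ek; elim/ltn_ind: (u N) => v IH k leNk ek.
  have [[k' leNk' lt]|nex] := classic (exists2 k', (N <= k')%N & (u k' < v)%N).
    exact: (IH _ lt k').
  exists k; split=> // k' leNk'; rewrite ek leqNgt; apply/negP => lt.
  by apply: nex; exists k'.
pose g N := proj1_sig (constructive_indefinite_description _ (min N)).
have gP N : (N <= g N)%N /\ forall k, (N <= k)%N -> (u (g N) <= u k)%N.
  exact: proj2_sig (constructive_indefinite_description _ (min N)).
pose phi := fix phi i := if i is j.+1 then g (phi j).+1 else g 0.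
have mono i : (phi i < phi i.+1)%N by case: (gP (phi i).+1).
exists phi => // i j leij.
have lep := strict_mono_leq mono leij.
case: i leij lep => [|i] leij lep; first by apply: (gP 0).2.
apply: (gP (phi i).+1).2.
by apply: leq_trans (mono i) lep.
Qed.

(** Subsequences are extracted for one coordinate after the other; once all coordinates are
    nondecreasing, the first two terms will do. *)
Lemma dickson n (m : nat -> 'X_{1..n}) :
  exists i j, (i < j)%N /\ (m i <= m j)%MM.
Proof.
suff H N : exists2 phi : nat -> nat, (forall i, phi i < phi i.+1)%N
    & forall (k : 'I_n) i j, (k < N)%N -> (i <= j)%N ->
      (m (phi i) k <= m (phi j) k)%N.
  have [phi mono le] := H n; exists (phi 0), (phi 1); split=> //.
  by apply/mnm_lepP => k; apply: le.
elim: N => [|N [phi mono IH]]; first by exists id.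
have [ltNn|leNn] := ltnP N n; last first.
  by exists phi => // k i j _; apply: IH; apply: leq_trans leNn.
have [psi mono' le] :=
  nondecreasing_subsequence (fun i => m (phi i) (Ordinal ltNn)).
have psi_le i j : (i <= j)%N -> (psi i <= psi j)%N.
  exact: strict_mono_leq.
exists (phi \o psi) => [i|k i j].
  by apply: leq_trans (mono _) _; apply: strict_mono_leq.
rewrite ltnS leq_eqVlt => /predU1P[ek leij|ltkN leij].
  have -> : k = Ordinal ltNn by apply: val_inj.
  exact: le.
by apply: IH => //; apply: psi_le.
Qed.

Section Noetherian.
Variables (K : fieldType) (n : nat).
Local Notation R := {mpoly K[n]}.
Implicit Types (I J : R -> Prop) (f g : R).


(** The larger ideal comes first, so that well-foundedness is the ascending chain condition. *)
Definition strictly_contains J' J : Prop :=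
  [/\ is_ideal J', is_ideal J, forall f, J f -> J' f & exists2 f, J' f & ~ J f].

(** Otherwise the leading term of any element of [J'] cancels against an element of [J], and
    induction on the leading monomial puts all of [J'] into [J]. *)
Lemma new_lead J J' : strictly_contains J' J ->
  exists f, [/\ J' f, f != 0 &
    forall g, J g -> g != 0 -> mlead g <> mlead f].
Proof.
move=> [iJ' iJ sJ [f0 hf0 nf0]]; apply: NNPP => no; apply: nf0.
have {}no f : J' f -> f != 0 -> exists g, [/\ J g, g != 0 & mlead g = mlead f].
  move=> hf nzf; apply: NNPP => no'; apply: no; exists f; split=> // g hg nzg e.
  by apply: no'; exists g.
elim/mleadrect: f0 hf0 => f IH hf.
have [->|nzf] := eqVneq f 0; first exact: (ideal0 iJ).
have [g [hg nzg eg]] := no f hf nzf.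
pose q : R := (mleadc f / mleadc g)%:MP * g.
have jq : J q by apply: (idealM iJ).
suff hh : J (f - q) by rewrite -(subrK q f); apply: (idealD iJ).
have [->|nzh] := eqVneq (f - q) 0; first exact: (ideal0 iJ).
apply: IH; last first.
  by apply: (idealD iJ') => //; rewrite -mulN1r; apply: (idealM iJ'); apply: sJ.
rewrite lt_neqAle; apply/andP; split.
  apply/eqP => e; move: nzh; rewrite -mleadc_eq0 e mcoeffB mcoeffCM.
  by rewrite -{3}eg divfK ?subrr ?eqxx // mleadc_eq0.
apply: le_trans (mleadB_le _ _) _.
by rewrite leUx lexx /= -eg /q mul_mpolyC mleadZ_le.
Qed.

(** An infinite ascending chain yields, by [new_lead], elements [f i] of [s i.+1] whose leading
    monomials do not occur in [s i]. By [dickson] the leading monomial of some [f i] divides that of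
    a later [f j], and a monomial multiple of [f i], which lies in [s j], attains it. *)
Lemma strictly_contains_wf : well_founded strictly_contains.
Proof.
move=> J0; apply: NNPP => nacc0.
pose T := {J : R -> Prop | ~ Acc strictly_contains J}.
have step (J : T) : exists J' : T, strictly_contains (sval J') (sval J).
  case: J => J nacc; apply: NNPP => no; apply: (nacc); split=> J' hJ'.
  by apply: NNPP => nacc'; apply: no; exists (exist _ J' nacc').
pose next (J : T) : T := sval (constructive_indefinite_description _ (step J)).
pose s := fix s i : T := if i is j.+1 then next (s j) else exist _ J0 nacc0.
have sP i : strictly_contains (sval (s i.+1)) (sval (s i)).
  exact: proj2_sig (constructive_indefinite_description _ (step (s i))).
pose f i := sval (constructive_indefinite_description _ (new_lead (sP i))).
have fP i : [/\ sval (s i.+1) (f i), f i != 0 &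
    forall g, sval (s i) g -> g != 0 -> mlead g <> mlead (f i)].
  exact: proj2_sig (constructive_indefinite_description _ (new_lead (sP i))).
have s_mono i j : (i <= j)%N -> forall g, sval (s i) g -> sval (s j) g.
  move=> /subnK <-; elim: (j - i)%N => // k IHk g hg; rewrite addSn.
  by have [_ _ sub _] := sP (k + i)%N; apply/sub/IHk.
have [i [j [ltij le_ij]]] := dickson (fun i => mlead (f i)).
have [hfi nzi _] := fP i; have [_ nzj hj] := fP j.
have nzX : 'X_[mlead (f j) - mlead (f i)] != 0 :> R.
  by apply/eqP => /(congr1 (mcoeff (mlead (f j) - mlead (f i)))) /eqP;
     rewrite mcoeffX eqxx mcoeff0 oner_eq0.
apply: (hj ('X_[mlead (f j) - mlead (f i)] * f i)).
- apply: (s_mono i.+1) => //.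
  by have [iJ _ _ _] := sP i; apply: (idealM iJ).
- by rewrite mulf_neq0.
- by rewrite mleadM // mleadXm submK.
Qed.

Lemma ideal_noetherian_ind (P : (R -> Prop) -> Prop) :
  (forall J, is_ideal J -> (forall J', strictly_contains J' J -> P J') -> P J) ->
  forall J, is_ideal J -> P J.
Proof.
move=> H J; elim/(well_founded_ind strictly_contains_wf): J => J IH iJ.
by apply: H => // J' c; apply: IH => //; case: c.
Qed.

Lemma ideal_chain_stabilizes (s : nat -> R -> Prop) :
  (forall i, is_ideal (s i)) ->
  (forall i j f, (i <= j)%N -> s i f -> s j f) ->
  exists D, forall i f, s i f -> s D f.
Proof.
move=> ids mono; suff H J : is_ideal J -> forall i, s i = J ->
    exists D, forall i f, s i f -> s D f by apply: (H (s 0) _ 0).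
move: J; apply: ideal_noetherian_ind => J _ IH i eJ.
have [all|] := classic (forall j f, s j f -> s i f); first by exists i.
move=> /not_all_ex_not[j /not_all_ex_not[f nf]].
have [hj ni] := imply_to_and _ _ nf.
apply: (IH (s j) _ j) => //; rewrite -eJ; split=> //; last by exists f.
move=> g; apply: (mono); case: (leqP i j) => // /ltnW leji.
by case: ni; apply: mono hj.
Qed.

End Noetherian.

(** * Torsion and filter-regular linear forms *)

Section FilterRegular.
Variables (K : fieldType) (n : nat).
Local Notation R := {mpoly K[n]}.
Implicit Types (I J : R -> Prop) (f g : R).

(* f is killed in R/J by a power of the maximal ideal. *)
Inductive m_torsion J : R -> Prop :=
| m_torsion_mem f : J f -> m_torsion J f
| m_torsion_step f : (forall i, m_torsion J ('X_i * f)) -> m_torsion J f.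

Lemma m_torsionD J f g : is_ideal J -> m_torsion J f -> J g ->
  m_torsion J (f + g).
Proof.
move=> iJ tf; elim: tf g => [h hh|h _ IH] g hg.
  by apply: m_torsion_mem; apply: (idealD iJ).
apply: m_torsion_step => i; rewrite mulrDr; apply: IH.
exact: (idealM iJ).
Qed.

Lemma m_torsion_colon J u f : m_torsion (ideal_colon J u) f ->
  m_torsion J (f * u).
Proof.
elim=> [g hg|g _ IH]; first exact: m_torsion_mem.
by apply: m_torsion_step => i; rewrite mulrA.
Qed.

Lemma ideal_colon_ideal J u : is_ideal J -> is_ideal (ideal_colon J u).
Proof.
move=> iJ; rewrite /ideal_colon; split=> [|f g hf hg|f g hg].
- by rewrite mul0r; apply: (ideal0 iJ).
- by rewrite mulrDl; apply: (idealD iJ).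
- by rewrite -mulrA; apply: (idealM iJ).
Qed.

Lemma ideal_add_principal_ideal J u : is_ideal J ->
  is_ideal (ideal_add J (principal u)).
Proof.
move=> iJ; split=> [|f g|f g].
- exists 0, 0; split; rewrite ?addr0 //; first exact: (ideal0 iJ).
  by apply/principalP; exists 0; rewrite mul0r.
- move=> [a [b [ha /principalP[b' ->] ->]]] [c [d [hc /principalP[d' ->] ->]]].
  exists (a + c), ((b' + d') * u); split; first exact: (idealD iJ).
    by apply/principalP; exists (b' + d').
  by rewrite mulrDl addrACA.
- move=> [a [b [ha /principalP[b' ->] ->]]].
  exists (f * a), (f * b' * u); split; first exact: (idealM iJ).
    by apply/principalP; exists (f * b').
  by rewrite mulrDr mulrA.
Qed.

(** A matrix [A] of maximal rank among those with row space inside [W] has row space [W]. Some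
    column of its cokernel matrix does not vanish at [v0]; that column is the functional. *)
Lemma subspace_functional (W : 'rV[K]_n -> Prop) (v0 : 'rV[K]_n) :
  W 0 -> (forall a u v, W u -> W v -> W (a *: u + v)) -> ~ W v0 ->
  exists2 c : 'rV[K]_n, c != 0 & forall w, W w -> \sum_i c ord0 i * w ord0 i = 0.
Proof.
move=> W0 WD nW.
pose inW (A : 'M[K]_n) := forall w : 'rV_n, (w <= A)%MS -> W w.
have [A AW maxA] : exists2 A, inW A & forall w, W w -> (w <= A)%MS.
  have [A AW] : exists A, inW A by exists 0 => w; rewrite submx0 => /eqP ->.
  have [k] := ubnP (n - \rank A); elim: k A AW => // k IH A AW ltk.
  have [?|] := classic (forall w, W w -> (w <= A)%MS); first by exists A.
  move=> /not_all_ex_not[w nw]; have [Ww nA] := imply_to_and _ _ nw.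
  apply: (IH (A + w)%MS).
    move=> u /sub_addsmxP[[u1 u2] ->] /=; rewrite addrC.
    have -> : u2 *m w = u2 ord0 ord0 *: w.
      by rewrite [u2]mx11_scalar mul_scalar_mx mxE.
    by apply: WD => //; apply: AW; apply: submxMl.
  have lt : (\rank A < \rank (A + w))%N.
    rewrite ltn_neqAle mxrankS ?addsmxSl // andbT.
    apply/eqP => e; apply: nA.
    have := mxrank_leqif_sup (addsmxSl A w); rewrite -e => -[_].
    by rewrite eqxx => /esym h; apply: submx_trans h; apply: addsmxSr.
  have := rank_leq_col (A + w)%MS; lia.
have nv0 : v0 *m cokermx A != 0.
  by apply/eqP => e; apply: nW; apply: AW; rewrite submxE e.
have [j nj] : exists j, (v0 *m cokermx A) ord0 j != 0.
  apply: NNPP => no; case/eqP: nv0; apply/rowP => j; rewrite [RHS]mxE.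
  by apply/eqP/negPn/negP => h; apply: no; exists j.
exists (\row_i cokermx A i j).
  apply: contraNneq nj => /rowP e; rewrite mxE big1 // => i _.
  by have := e i; rewrite !mxE => ->; rewrite mulr0.
move=> w /maxA; rewrite submxE => /eqP/rowP/(_ j); rewrite !mxE => e.
by rewrite -[RHS]e; apply: eq_bigr => i _; rewrite mxE mulrC.
Qed.

(** With lists of functionals, finitely many such conditions combine by concatenation. *)
Definition off_hyperplanes (cs : seq 'rV[K]_n) (a : 'I_n -> K) : Prop :=
  forall c, c \in cs -> \sum_i c ord0 i * a i != 0.

(* Noetherian induction: when u v lies in J but u and v do not, the exact      *)
(* sequence 0 -> R/(J : u) -> R/J -> R/(J + (u)) -> 0 reduces J to strictly    *)
(* larger ideals, and a prime J only excludes the proper subspace of linear   *)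
(* forms it contains.                                                         *)
Lemma general_form_filter_regular J : is_ideal J ->
  exists2 cs : seq 'rV[K]_n, (forall c, c \in cs -> c != 0)
    & forall a, off_hyperplanes cs a ->
        forall f, J (f * linear_form a) -> m_torsion J f.
Proof.
move: J; apply: ideal_noetherian_ind => J iJ IH.
have [mJ|] := classic (forall i, J 'X_i).
  exists [::] => // a _ f _; apply: m_torsion_step => i.
  by apply: m_torsion_mem; rewrite mulrC; apply: (idealM iJ).
move=> /not_all_ex_not[i0 nXi0].
have [prime|] := classic (forall u v, J (u * v) -> J u \/ J v).
  pose W (w : 'rV[K]_n) := J (linear_form (fun i => w ord0 i)).
  have [|||c nzc hc] := @subspace_functional W (delta_mx ord0 i0).
  - rewrite /W /linear_form big1; first exact: (ideal0 iJ).
    by move=> i _; rewrite mxE scale0r.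
  - move=> a u v hu hv; rewrite /W.
    suff -> : linear_form (fun i => (a *: u + v) ord0 i) = a%:MP *
        linear_form (fun i => u ord0 i) + linear_form (fun i => v ord0 i).
      by apply: (idealD iJ) => //; apply: (idealM iJ).
    rewrite mul_mpolyC /linear_form scaler_sumr -big_split; apply: eq_bigr => i _.
    by rewrite !mxE scalerDl scalerA.
  - rewrite /W /linear_form (bigD1 i0) //= big1 ?addr0 => [|i ni].
      by rewrite mxE !eqxx scale1r.
    by rewrite mxE eqxx (negbTE ni) scale0r.
  exists [:: c] => [c'|a off f hf]; first by rewrite inE => /eqP ->.
  apply: m_torsion_mem; case: (prime _ _ hf) => // hx.
  have /eqP[] := off c (mem_head _ _); rewrite -[RHS](hc (\row_i a i)).
    by apply: eq_bigr => i _; rewrite mxE.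
  rewrite /W; congr (J _): hx; apply: eq_bigr => i _; by rewrite mxE.
move=> /not_all_ex_not[u /not_all_ex_not[v nuv]].
have [huv /not_or_and[nu nv]] := imply_to_and _ _ nuv.
have [|cs1 nz1 h1] := IH (ideal_add J (principal u)).
  split=> //; first exact: ideal_add_principal_ideal.
    move=> f hf; exists f, 0; split; rewrite ?addr0 //.
    by apply/principalP; exists 0; rewrite mul0r.
  exists u => //; exists 0, u; split; rewrite ?add0r //; first exact: (ideal0 iJ).
  by apply/principalP; exists 1; rewrite mul1r.
have [|cs2 nz2 h2] := IH (ideal_colon J u).
  split=> //; first exact: ideal_colon_ideal.
    by move=> f hf; rewrite /ideal_colon mulrC; apply: (idealM iJ).
  by exists v => //; rewrite /ideal_colon mulrC.
exists (cs1 ++ cs2) => [c|a off f hf].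
  by rewrite mem_cat => /orP[/nz1|/nz2].
have off1 : off_hyperplanes cs1 a.
  by move=> c hc; apply: off; rewrite mem_cat hc.
have off2 : off_hyperplanes cs2 a.
  by move=> c hc; apply: off; rewrite mem_cat hc orbT.
have : m_torsion (ideal_add J (principal u)) f.
  apply: (h1 a off1); exists (f * linear_form a), 0; split=> //.
    by apply/principalP; exists 0; rewrite mul0r.
  by rewrite addr0.
(* Induction on the torsion of [f] modulo [J + (u)], with [x] the linear form. At its end
   [f = j + h u]; then [h u x] is in [J], so [h] is torsion modulo [J : u], and [h u] is torsion
   modulo [J]. *)
move=> tf; elim: tf hf => [g [j [h' [hj /principalP[h ->] ->]]] hg|g _ IHg hg].
  rewrite addrC; apply: m_torsionD => //; apply: m_torsion_colon.
  apply: (h2 a off2); rewrite /ideal_colon mulrAC.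
  have -> : h * u * linear_form a = (j + h * u) * linear_form a
      + (-1) * (linear_form a * j).
    by rewrite mulN1r mulrDl (mulrC j) addrAC subrr add0r.
  by apply: (idealD iJ) => //; do 2!apply: (idealM iJ).
apply: m_torsion_step => i; apply: IHg; rewrite -mulrA.
exact: (idealM iJ).
Qed.

End FilterRegular.

Section GeneralPoint.
Variables (K : fieldType).
Hypothesis infinite_K : infinite_type K.

Lemma infinite_nonroot (p : {poly K}) : p != 0 -> exists t, p.[t] != 0.
Proof.
move=> nzp; apply: NNPP => no.
have [s [us ss]] : exists s : seq K, uniq s /\ size s = size p.
  elim: (size p) => [|k [s [us <-]]]; first by exists [::].
  have [t nt] := infinite_K s; exists (t :: s); by rewrite /= nt us.
suff h : all (root p) s by have := max_poly_roots nzp h us; rewrite ss ltnn.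
by apply/allP => t _; apply/negPn/negP => nt; apply: no; exists t.
Qed.

(* A nonzero functional restricts to a nonzero polynomial on the moment curve *)
(* t |-> (1, t, t^2, ..).                                                     *)
Lemma off_hyperplanes_nonempty n (cs : seq 'rV[K]_n) :
  (forall c, c \in cs -> c != 0) -> exists a, off_hyperplanes cs a.
Proof.
move=> nz; pose P (c : 'rV[K]_n) : {poly K} := \sum_i c ord0 i *: 'X^i.
have nzP c : c != 0 -> P c != 0.
  apply: contraNneq => e; apply/eqP/rowP => i; rewrite mxE.
  have := congr1 (fun q : {poly K} => q`_i) e; rewrite coef0 coef_sum.
  rewrite (bigD1 i) //= coefZ coefXn eqxx mulr1 big1 ?addr0 // => j nji.
  by rewrite coefZ coefXn eq_sym (inj_eq val_inj) (negbTE nji) mulr0.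
have [t] : exists t, (\prod_(c <- cs) P c).[t] != 0.
  apply: infinite_nonroot; rewrite prodf_seq_neq0; apply/allP => c hc /=.
  exact/nzP/nz.
rewrite horner_prod prodf_seq_neq0 => /allP ht; exists (fun i => t ^+ i) => c hc.
have /= := ht c hc; suff -> : (P c).[t] = \sum_i c ord0 i * t ^+ i by [].
by rewrite horner_sum; apply: eq_bigr => i _; rewrite hornerZ hornerXn.
Qed.

Lemma off_hyperplanes_open n (cs : seq 'rV[K]_n) :
  zariski_open (off_hyperplanes cs).
Proof.
exists (fun f => f = \prod_(c <- cs) linear_form (fun i => c ord0 i)) => a.
have e : (\prod_(c <- cs) linear_form (fun i => c ord0 i)).@[a] =
    \prod_(c <- cs) \sum_i c ord0 i * a i.
  rewrite rmorph_prod; apply: eq_bigr => c _; rewrite raddf_sum.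
  by apply: eq_bigr => i _; rewrite /= mevalZ mevalXU.
split=> [off|[_ -> ]]; last first.
  by rewrite e prodf_seq_neq0 => /allP h c /h.
eexists; first reflexivity.
by rewrite e prodf_seq_neq0; apply/allP => c hc; apply: off.
Qed.

End GeneralPoint.

(** * Regularity and hyperplane sections *)

Section Regular.
Variable K : fieldType.

(* G resolves, up to homology of low degree, the cyclic module R/J: the basis *)
(* vector [e] identifies G_0 with R.                                          *)
Definition presents n (G : free_complex K n) (J : {mpoly K[n]} -> Prop) : Prop :=
  exists e : 'rV[{mpoly K[n]}]_(fc_rk G 0),
    [/\ homog_vec 0 e, forall t : 'rV_(fc_rk G 0), exists f, t = f *: e
      & forall f, J f <-> fc_im (f *: e)].

Definition regular_ideal n (J : {mpoly K[n]} -> Prop) (d : nat) : Prop :=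
  exists G, [/\ exact_from G 0 d%:Z, torK_from G d%:Z & presents G J].

Lemma regular_ideal_ext n (J J' : {mpoly K[n]} -> Prop) d :
  (forall f, J f <-> J' f) -> regular_ideal J d -> regular_ideal J' d.
Proof.
move=> e [G [ex tor [v [h1 h2 h3]]]]; exists G; split=> //.
by exists v; split=> // f; rewrite -e.
Qed.

Section OfResolution.
Variables (n : nat) (J : {mpoly K[n]} -> Prop) (F : graded_free_resolution J).

(** The resolution of [J] is prolonged by its augmentation to R, placed in homological degree 0.
    This resolves R/J, with indices shifted by one. *)
Definition res_rk i := if i is j.+1 then rk F j else 1%N.
Definition res_deg i : 'I_(res_rk i) -> int :=
  match i with 0 => fun=> 0 | j.+1 => @gdeg _ _ _ F j end.
Definition res_d i : 'M[{mpoly K[n]}]_(res_rk i.+1, res_rk i) :=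
  match i with 0 => aug F | j.+1 => diff F j end.

Lemma res_graded i a b m : m \in msupp (res_d i a b) ->
  res_deg a = res_deg b + (mdeg m)%:Z.
Proof.
case: i a b => [|i] a b /=; last exact: diff_graded.
by rewrite add0r (ord1 b); apply: aug_graded.
Qed.

Lemma res_dd i : res_d i.+1 *m res_d i = 0.
Proof.
apply/row_matrixP => a; rewrite rowE mulmxA row0.
case: i a => [|i] a.
  by apply/exact0; exists (delta_mx ord0 a).
by apply/exactS; exists (delta_mx ord0 a).
Qed.

Definition res_complex : free_complex K n := FreeComplex res_graded res_dd.

Lemma res_presents : presents res_complex J.
Proof.
exists (const_mx 1); split.
- by apply/rowP => a; rewrite !mxE (hcomp_homog _ (dhomog1 _ _)).
- move=> t; exists (t ord0 ord0); apply/rowP => a.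
  by rewrite !mxE mulr1 (ord1 a).
move=> f; rewrite (aug_image F f); split=> -[v hv]; exists v.
  by apply/rowP => a; rewrite -hv mxE [const_mx _ _ _]mxE mulr1 (ord1 a).
by move/rowP/(_ ord0): hv; rewrite mxE [const_mx _ _ _]mxE mulr1.
Qed.

End OfResolution.

Lemma linear_resolution_regular n (J : {mpoly K[n]} -> Prop) d :
  has_linear_resolution J d -> regular_ideal J d.
Proof.
move=> [F lin]; exists (res_complex F); split; last exact: res_presents.
  move=> [|i] k _ _ v _ hv; first exact/exact0.
  exact/exactS.
(* Because of the shift, [torK_at] at index p is the vanishing of Tor_p of [J]; as [k - p > d],
   linearity applies. *)
move=> [|i] k hk v homv hv.
  have tor : Tor_vanishes F 0 (0 + k) by apply: lin; lia.
  have [|//|w _ ->] := tor v; last by exists w.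
  by move=> a ha; rewrite add0r; apply: homv.
have tor : Tor_vanishes F i.+1 k.
  by rewrite -(subrKC i.+1%:Z k); apply: lin; lia.
by have [//|//|w _ ->] := tor v; exists w.
Qed.

Lemma homog1_linear_form n (l : {mpoly K[n]}) : l \is 1.-homog ->
  l = linear_form (fun i => l@_U_(i)%MM).
Proof.
move=> hl; apply/mpolyP => m.
have [/mdeg1P[i /eqP ->]|nm] := boolP (mdeg m == 1%N).
  by rewrite mcoeff_linear_form.
rewrite (dhomog_nemf_coeff hl nm).
by rewrite (dhomog_nemf_coeff (linear_form_homog _) nm).
Qed.

Lemma ideal_sum n (J : {mpoly K[n]} -> Prop) (T : Type) (s : seq T) F :
  is_ideal J -> (forall t, J (F t)) -> J (\sum_(t <- s) F t).
Proof.
move=> iJ hF; elim/big_ind: _ => //; first exact: (ideal0 iJ).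
exact: (idealD iJ).
Qed.

(** This is [socle_vanishes] in homological degree 0, where every vector is a cycle, read through
    the identification of G_0 with R. *)
Lemma regular_no_socle n (J : {mpoly K[n.+1]} -> Prop) d e f :
  is_ideal J -> regular_ideal J d -> (d <= e)%N -> f \is e.-homog ->
  (forall i, J ('X_i * f)) -> J f.
Proof.
move=> iJ [G [ex tor [v [homv gen hJ]]]] lede homf soc; apply/hJ.
apply: (@socle_vanishes _ _ G 0 d%:Z e%:Z) => //.
- by rewrite addr0 lez_nat.
- by have := vproj_scale (@fc_deg _ _ G 0) 0 v homf; rewrite add0r homv.
move=> l /homog1_linear_form ->; rewrite scalerA; apply/hJ.
rewrite mulr_suml; apply: ideal_sum => // i.
by rewrite -mul_mpolyC -mulrA; apply: (idealM iJ).
Qed.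

Lemma vproj_scale0 n (G : free_complex K n) k f
    (v : 'rV[{mpoly K[n]}]_(fc_rk G 0)) :
  homog_vec 0 v -> vproj (@fc_deg _ _ G 0) k (f *: v) = hcomp k f *: v.
Proof.
move=> /rowP homv; apply/rowP => a; rewrite !mxE.
have := homv a; rewrite !mxE sub0r => <-.
case: (- fc_deg a) => g /=; last by rewrite !mulr0 linear0.
by rewrite hcompM //; apply: pihomogP.
Qed.

(** The complex G/xG presents the image of [J]. Its H_1 in degree [k >= d + 1] is governed by the
    kernel of [x] on R/J in degree [k - 1 >= d], which vanishes by assumption; the higher homology
    is handled by the exactness of G. *)
Lemma regular_cut n m (J : {mpoly K[n]} -> Prop) d x
    (c : n.-tuple {mpoly K[m]}) :
  quotient_coords x c -> x != 0 -> x \is 1.-homog ->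
  (forall e f, (d <= e)%N -> f \is e.-homog -> J (f * x) -> J f) ->
  regular_ideal J d -> regular_ideal (image_ideal c J) d.
Proof.
move=> qc nzx hx inj [G [ex tor [v [homv gen hJ]]]].
exists (cut (coords_linear qc) G); split.
- case=> [|i] k _ hk; last first.
    by apply: (cut_exactS qc nzx hx); apply: ex => //; lia.
  apply: (cut_exact qc nzx hx); last exact: ex.
  move=> t homt imt; have [f et] := gen t.
  have := homt; rewrite /homog_vec et vproj_scale0 // => et'.
  rewrite -et'; apply/hJ.
  have [g eg] : exists g : nat, k - 1 = g%:Z by exists `|k - 1|%N; lia.
  rewrite eg; apply: (inj g); first lia.
    exact: pihomogP.
  by apply/hJ; rewrite mulrC -scalerA -eg et' -et.
- by move=> i k hk; apply/cut_torK/tor.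
exists (map_mx (comp_mpoly c) v); split.
- by rewrite /homog_vec vproj_map_comp ?homv //; apply: coords_linear qc.
- move=> t; have [t' <-] := map_comp_surj qc t; have [f ->] := gen t'.
  by exists (f \mPo c); rewrite map_comp_scale.
move=> q; split=> [[p /hJ [w hw] ->]|[z hz]].
  by exists (map_mx (comp_mpoly c) w); rewrite -map_comp_scale hw map_mxM.
have [p0 ep0] := coords_surj qc q; have [z' ez'] := map_comp_surj qc z.
have [|t ht] := map_comp_eq0 qc (v := p0 *: v - z' *m fc_d G 0).
  by rewrite map_mxB map_mxM map_comp_scale ep0 ez' hz subrr.
have [f et] := gen t; exists (p0 - x * f); last first.
  by rewrite linearB /= rmorphM /= (quotient_coords_x qc) mul0r subr0.
apply/hJ; exists z'; rewrite scalerBl -scalerA -et -ht.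
by rewrite opprB addrC subrK.
Qed.

End Regular.

(** * Componentwise linear ideals *)

Section IdealGen.
Variables (K : fieldType) (n : nat).
Local Notation R := {mpoly K[n]}.
Implicit Types (S I J : R -> Prop) (f g : R).

Lemma ideal_gen_ideal S : is_ideal (ideal_gen S).
Proof.
split=> [|f g [s hs ->] [t ht ->]|f g [s hs ->]].
- by exists [::]; rewrite ?big_nil.
- exists (s ++ t); rewrite ?big_cat // => c.
  by rewrite mem_cat => /orP[/hs|/ht].
exists [seq (f * c.1, c.2) | c <- s] => [c /mapP[c' /hs h ->] //|].
by rewrite big_map mulr_sumr; apply: eq_bigr => c _; rewrite mulrA.
Qed.

Lemma mem_ideal_gen S f : S f -> ideal_gen S f.
Proof.
move=> hf; exists [:: (1, f)]; last by rewrite big_seq1 mul1r.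
by move=> c; rewrite inE => /eqP ->.
Qed.

Lemma ideal_gen_elim S (P : R -> Prop) :
  P 0 -> (forall f g, P f -> P g -> P (f + g)) ->
  (forall f g, S g -> P (f * g)) -> forall f, ideal_gen S f -> P f.
Proof.
move=> P0 PD PM f [s hs ->]; rewrite big_seq.
by elim/big_ind: _ => // c /hs; apply: PM.
Qed.

Lemma ideal_gen_min S J : is_ideal J -> (forall f, S f -> J f) ->
  forall f, ideal_gen S f -> J f.
Proof.
move=> iJ hS; apply: ideal_gen_elim => [|f g|f g /hS]; first exact: (ideal0 iJ).
  exact: (idealD iJ).
exact: (idealM iJ).
Qed.

Lemma degree_part_ideal I d : is_ideal (degree_part I d).
Proof. exact: ideal_gen_ideal. Qed.

Lemma degree_part_sub I d f : is_ideal I -> degree_part I d f -> I f.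
Proof. by move=> iI; apply: ideal_gen_min => // g []. Qed.

Lemma hcomp_sum f : exists k, f = \sum_(d < k) pihomog mdeg d f.
Proof. by exists (mmeasure mdeg f); apply: pihomog_partitionE. Qed.

Lemma mnm_split (m : 'X_{1..n}) s : (s <= mdeg m)%N ->
  exists m1 m2, m = (m1 + m2)%MM /\ mdeg m1 = s.
Proof.
elim: s => [|s IH] lt; first by exists 0%MM, m; rewrite add0m mdeg0.
have [m1 [m2 [em es]]] := IH (ltnW lt).
have nm2 : m2 != 0%MM.
  by apply: contraTneq lt => e; rewrite em e addm0 es ltnn.
have [i ni] : exists i, m2 i != 0%N.
  apply: NNPP => no; case/eqP: nm2; apply/mnmP => i; rewrite mnm0E.
  by apply/eqP/negPn/negP => h; apply: no; exists i.
exists (m1 + U_(i))%MM, (m2 - U_(i))%MM; split; last by rewrite mdegD mdeg1 es addn1.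
by rewrite -addmA [(U_(i) + _)%MM]addmC submK // lep1mP.
Qed.

(** Each monomial of [a] splits as [m1 m2] with [m1] of degree [j - e], so that [m1 b] is an element
    of [I] of degree [j]. *)
Lemma degree_part_mul I e s j a b : is_ideal I -> I b -> b \is e.-homog ->
  a \is s.-homog -> (e <= j <= e + s)%N -> degree_part I j (a * b).
Proof.
move=> iI hb homb homa /andP[lej ljs].
rewrite [a]mpolyE mulr_suml big_seq.
elim/big_ind: _ => [|f g|m hm]; first exact: (ideal0 (degree_part_ideal _ _)).
  exact: (idealD (degree_part_ideal _ _)).
have em := dhomog_mf homa hm.
have [|m1 [m2 [-> em1]]] := @mnm_split m (j - e).
  by rewrite /= in em; rewrite em; lia.
rewrite mpolyXD [_ * 'X_[m2]]mulrC scalerAl -mulrA.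
apply: (idealM (degree_part_ideal _ _)); apply: mem_ideal_gen; split.
  exact: (idealM iI).
have -> : j = (mdeg m1 + e)%N by lia.
by apply: dhomogM => //; rewrite dhomogX.
Qed.

(** By Noetherianity [I] is generated in degrees up to some [D]. In a multiple of such a generator
    of degree at least [j], enough of the cofactor can be moved to the generator to bring it to
    degree [j]. *)
Lemma degree_part_stable I : homogeneous_ideal I ->
  exists D, forall j k f, (D <= j <= k)%N -> I f -> f \is k.-homog ->
    degree_part I j f.
Proof.
move=> hI; have iI := hI.1.
pose s d := ideal_gen (fun f => I f /\ exists2 e, (e <= d)%N & f \is e.-homog).
have [||D hD] := @ideal_chain_stabilizes _ _ s.
- by move=> d; apply: ideal_gen_ideal.
- move=> i j f leij; apply: ideal_gen_min; first exact: ideal_gen_ideal.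
  move=> g [hg [e lee home]]; apply: mem_ideal_gen; split=> //.
  by exists e => //; apply: leq_trans leij.
exists D => j k f /andP[leDj lejk] hf homf.
have : s D f by apply: (hD k); apply: mem_ideal_gen; split=> //; exists k.
(* Passing to the component of degree [k] gives a claim about all elements of [s D], homogeneous or
   not, that is stable under sums. *)
rewrite -{2}[f](pihomog_dE homf) -[pihomog _ _ _]/(hcomp k%:Z f).
move: {hf homf} f; apply: ideal_gen_elim => [|f g|f g [hg [e lee homg]]].
- by rewrite linear0; apply: (ideal0 (degree_part_ideal _ _)).
- by rewrite linearD; apply: (idealD (degree_part_ideal _ _)).
have -> : k%:Z = (k - e)%N%:Z + e%:Z by lia.
rewrite hcompM //; apply: (@degree_part_mul I e (k - e)) => //; last by lia.
exact: pihomogP.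
Qed.

(* The degree e+1 part of m I is R_1 I_e, so it only depends on I_<e>. *)
Lemma maximal_mul_hcomp I e f : homogeneous_ideal I ->
  ideal_mul (@maximal_ideal K n) I f -> degree_part I e (hcomp (e%:Z + 1) f).
Proof.
move=> hI; have iI := hI.1; have iP := degree_part_ideal I e.
move: f; apply: ideal_gen_elim => [|f g|p _ [g [h [hg hh ->]]]].
- by rewrite linear0; apply: (ideal0 iP).
- by rewrite linearD; apply: (idealD iP).
move: g hg p; apply: ideal_gen_elim => [p|f g hf hg p|q _ [i ->] p].
- by rewrite mul0r mulr0 linear0; apply: (ideal0 iP).
- by rewrite mulrDl mulrDr linearD; apply: (idealD iP); [apply: hf|apply: hg].
have [N ->] := hcomp_sum h; rewrite !mulr_sumr linear_sum.
apply: ideal_sum => // d; set h' := pihomog mdeg d h.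
have homh : h' \is d.-homog by apply: pihomogP.
have -> : p * (q * 'X_i * h') = p * q * h' * 'X_i.
  by rewrite -!mulrA ['X_i * _]mulrC.
rewrite -[X in degree_part I e X]/(hcomp (e%:Z + 1%:Z) (p * q * h' * 'X_i)).
rewrite (hcompM _ _ (mpolyX1_homog K i)).
rewrite mulrC; apply: (idealM iP).
have [led|ltd] := leqP d e.
  have -> : e%:Z = (e - d)%N%:Z + d%:Z by lia.
  rewrite hcompM //; apply: mem_ideal_gen; split.
    by apply: (idealM iI); apply: hI.2.
  by rewrite -{2}(subnK led); apply: dhomogM => //; apply: pihomogP.
(* For [d > e] the cofactor of [h'] would need negative degree, so the component is zero. *)
have -> : e%:Z = Negz (d - e).-1 + d%:Z by lia.
by rewrite hcompM // mul0r; apply: (ideal0 iP).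
Qed.

Lemma ideal_mul_maximal I (a : 'I_n -> K) f : I f ->
  ideal_mul (@maximal_ideal K n) I (f * linear_form a).
Proof.
move=> hf; rewrite mulrC mulr_suml; apply: ideal_sum => [|i].
  exact: ideal_gen_ideal.
rewrite -scalerAl -mul_mpolyC; apply: (idealM (ideal_gen_ideal _)).
apply: mem_ideal_gen; exists 'X_i, f; split=> //.
by apply: mem_ideal_gen; exists i.
Qed.

End IdealGen.

(** * The image of an ideal in R/xR *)

Section Image.
Variables (K : fieldType) (n k : nat) (x : {mpoly K[n]}).
Variable c : n.-tuple {mpoly K[k]}.
Hypothesis qc : quotient_coords x c.
Variable I : {mpoly K[n]} -> Prop.
Hypothesis hI : homogeneous_ideal I.

Lemma image_ideal_ideal J : is_ideal J -> is_ideal (image_ideal c J).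
Proof.
move=> iJ; split=> [|_ _ [p hp ->] [q hq ->]|f _ [q hq ->]].
- by exists 0; [apply: (ideal0 iJ) | rewrite linear0].
- by exists (p + q); [apply: (idealD iJ) | rewrite linearD].
have [p <-] := coords_surj qc f.
by exists (p * q); [apply: (idealM iJ) | rewrite rmorphM].
Qed.

Lemma image_ideal_add_principal q :
  image_ideal c (ideal_add I (principal x)) q <-> image_ideal c I q.
Proof.
split=> [[_ [g [h [hg /principalP[h' ->] ->]] ->]]|[p hp ->]].
  exists g => //.
  by rewrite linearD /= rmorphM /= (quotient_coords_x qc) mulr0 addr0.
exists p => //; exists p, 0; split; rewrite ?addr0 //.
by apply/principalP; exists 0; rewrite mul0r.
Qed.

Lemma image_ideal_homogeneous :
  homogeneous_ideal (image_ideal c (ideal_add I (principal x))).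
Proof.
split; first exact/image_ideal_ideal/ideal_add_principal_ideal/hI.1.
move=> q d /image_ideal_add_principal[p hp ->]; apply/image_ideal_add_principal.
exists (pihomog mdeg d p); first exact: hI.2.
exact: (hcomp_comp_mpoly (coords_linear qc) d%:Z).
Qed.

(** Substitution keeps degrees and constant terms: if [p] in [I] maps to 1, its component of degree
    0 is 1, and it lies in [I] by homogeneity. *)
Lemma image_ideal_proper : ~ I 1 ->
  ~ image_ideal c (ideal_add I (principal x)) 1.
Proof.
move=> proper /image_ideal_add_principal[p hp e]; apply: proper.
have := hI.2 p 0 hp; suff -> : pihomog mdeg 0 p = 1 by [].
have hom := pihomogP mdeg 0 p.
apply/mpolyP => m; rewrite mcoeff1.
have [->|nm0] := eqVneq m 0%MM; last first.
  by rewrite (dhomog_nemf_coeff hom) ?mdeg_eq0.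
transitivity ((p \mPo c)@_0%MM); last by rewrite -e mcoeff1 eqxx.
have hc := hcomp_comp_mpoly (coords_linear qc) 0%:Z p.
rewrite -(mcoeff0_comp_mpoly (coords_linear qc)) -[pihomog _ _ _]/(hcomp 0%:Z p).
by rewrite -hc -e (hcomp_homog _ (dhomog1 _ _)).
Qed.

(** Taking components commutes with the substitution, so forms of degree [d] in the image lift to
    forms of degree [d] in [I]. This carries the invariant over to R/xR. *)
Lemma degree_part_image d q :
  image_ideal c (degree_part I d) q <->
  degree_part (image_ideal c (ideal_add I (principal x))) d q.
Proof.
have iJ := degree_part_ideal (image_ideal c (ideal_add I (principal x))) d.
split=> [[p hp ->]|].
  move: p hp; apply: ideal_gen_elim => [|f g|f g [hg homg]].
  - by rewrite linear0; apply: (ideal0 iJ).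
  - by rewrite linearD; apply: (idealD iJ).
  rewrite rmorphM /=; apply: (idealM iJ); apply: mem_ideal_gen; split.
    by apply/image_ideal_add_principal; exists g.
  have := hcomp_comp_mpoly (coords_linear qc) d%:Z g.
  by rewrite (hcomp_homog _ homg) eqxx => <-; apply: pihomogP.
apply: ideal_gen_min; first exact/image_ideal_ideal/degree_part_ideal.
move=> f [/image_ideal_add_principal[p hp ef] homf].
exists (hcomp d%:Z p); last first.
  rewrite -(hcomp_comp_mpoly (coords_linear qc)) -ef.
  by rewrite (hcomp_homog _ homf) eqxx.
by apply: mem_ideal_gen; split; [apply: hI.2 | apply: pihomogP].
Qed.

End Image.

Section General.
Variables (K : fieldType) (n : nat).
Variable I : {mpoly K[n.+1]} -> Prop.
Hypothesis hI : homogeneous_ideal I.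
Hypothesis regI : forall d, regular_ideal (degree_part I d) d.

(** Induction along the torsion: once all ['X_i * g] are in the ideal, [g] is a socle element of
    degree at least [d]. *)
Lemma m_torsion_homog_mem d e f : (d <= e)%N -> f \is e.-homog ->
  m_torsion (degree_part I d) f -> degree_part I d f.
Proof.
move=> lede homf tf; elim: tf e lede homf => // g _ IH e lede homg.
apply: (regular_no_socle (degree_part_ideal _ _) (regI d) lede homg) => i.
apply: (IH i e.+1); first exact: leqW.
by have := dhomogM (mpolyX1_homog K i) homg; rewrite add1n.
Qed.

Lemma general_form_regular :
  exists2 cs : seq 'rV[K]_n.+1, (forall c, c \in cs -> c != 0)
    & forall a, off_hyperplanes cs a -> forall d e f, (d <= e)%N ->
        f \is e.-homog -> degree_part I d (f * linear_form a) ->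
        degree_part I d f.
Proof.
have [D stable] := degree_part_stable hI.
have [cs nz hcs] : exists2 cs : seq 'rV[K]_n.+1, (forall c, c \in cs -> c != 0)
    & forall a, off_hyperplanes cs a -> forall d f, (d < D.+1)%N ->
        degree_part I d (f * linear_form a) -> m_torsion (degree_part I d) f.
  elim: D.+1 => [|k [cs nz IH]]; first by exists [::].
  have [cs' nz' h'] := general_form_filter_regular (degree_part_ideal I k).
  exists (cs ++ cs') => [c|a off d f].
    by rewrite mem_cat => /orP[/nz|/nz'].
  rewrite ltnS leq_eqVlt => /predU1P[->|ltd].
    by apply: h' => c hc; apply: off; rewrite mem_cat hc orbT.
  by apply: IH ltd => c hc; apply: off; rewrite mem_cat hc.
exists cs => // a off d e f lede homf hf.
have [ledD|ltDd] := leqP d D.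
  by apply: m_torsion_homog_mem homf _ => //; apply: hcs hf.
apply: (stable d e) => //; first by rewrite (ltnW ltDd).
(* Hyperplanes were collected only for indices up to [D]. For [d > D] the ideals [I_<d>] and [I_<D>]
   agree in degrees [>= d], so the claim is transferred to index [D]. *)
apply: (degree_part_sub hI.1 (d := D)).
have leDe : (D <= e)%N by apply: leq_trans lede; apply: ltnW.
apply: (m_torsion_homog_mem leDe homf); apply: (hcs a off) => //.
apply: (stable D e.+1); first by rewrite leqnn leqW.
  exact: degree_part_sub hI.1 hf.
by have := dhomogM homf (linear_form_homog a); rewrite addn1.
Qed.

End General.

Lemma regular_completely_mfull (K : fieldType) n (I : {mpoly K[n]} -> Prop) :
  infinite_type K -> homogeneous_ideal I -> ~ I 1 ->
  (forall d, regular_ideal (degree_part I d) d) -> completely_mfull I.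
Proof.
move=> infK; elim: n I => [|n IH] I hI proper regI.
  move=> f; split=> [hf|->]; last exact: (ideal0 hI.1).
  apply/eqP/negPn/negP => nzf; apply: proper.
  have ef := mpoly0_const f.
  have nz0 : f@_0%MM != 0.
    by apply: contraNneq nzf => e; rewrite ef e mpolyC0.
  have -> : 1 = (f@_0%MM)^-1%:MP * f by rewrite {2}ef -mpolyCM mulVf.
  exact: (idealM hI.1).
have [cs nz hcs] := general_form_regular hI regI.
(* The extra functional forces [a ord0 != 0], so that [x] is nonzero and the first variable can be
   eliminated modulo [x]. *)
have nzcs c : c \in delta_mx ord0 ord0 :: cs -> c != 0.
  rewrite inE => /predU1P[->|/nz //]; apply/eqP => /rowP/(_ ord0).
  by rewrite !mxE !eqxx => /eqP; rewrite oner_eq0.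
exists (off_hyperplanes (delta_mx ord0 ord0 :: cs)); split.
- exact: off_hyperplanes_open.
- exact: off_hyperplanes_nonempty.
move=> a off; have offcs : off_hyperplanes cs a.
  by move=> c hc; apply: off; rewrite inE hc orbT.
have {}hcs := hcs a offcs.
have nza : a ord0 != 0.
  have := off _ (mem_head _ _); rewrite (bigD1 ord0) //= big1 ?addr0.
    by rewrite mxE eqxx mul1r.
  by move=> i ni; rewrite mxE (negbTE ni) andbF mul0r.
split.
  move=> f; split=> [hf|hf]; last exact: ideal_mul_maximal.
  (* Degree by degree: the component of degree e + 1 of [f * x] is [x] times that of degree e of
     [f]. It lies in [I_<e>], where [x] can be cancelled. *)
  have [N ->] := hcomp_sum f; apply: ideal_sum; first exact: hI.1.
  move=> e; apply: (degree_part_sub hI.1 (d := e)).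
  apply: (hcs e e) => //; first exact: pihomogP.
  have := maximal_mul_hcomp e hI hf.
  by rewrite (hcompM _ _ (linear_form_homog a)).
have [c qc] := quotient_coords_linear_form nza.
have nzx : linear_form a != 0.
  by apply: contraNneq nza => x0; rewrite -mcoeff_linear_form x0 mcoeff0.
exists c; split=> //; apply: IH.
- exact: image_ideal_homogeneous.
- exact: image_ideal_proper.
move=> d; apply: (regular_ideal_ext (degree_part_image qc hI d)).
apply: (regular_cut qc nzx (linear_form_homog a)) (regI d) => e f.
exact: hcs.
Qed.

Theorem proposition18 (K : fieldType) (n : nat) (I : {mpoly K[n]} -> Prop)
  (infinite_K : infinite_type K)
  (homogeneous_I : homogeneous_ideal I)
  (proper_I : ~ I 1)
  (linear_I : componentwise_linear I) :
  completely_mfull I.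
Proof.
apply: regular_completely_mfull => // d.
exact: linear_resolution_regular.
Qed.
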